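(* Let $\mathcal{H}_K$ be a contractive analytic Hilbert space on $\mathbb{B}^n$ and let $\mathcal{E}_*$ be an arbitrary Hilbert space. Let $\mathcal{S}=\Theta H^2_n(\mathcal{E})$ be a closed $M_z$-invariant subspace of $\mathcal{H}_K\otimes\mathcal{E}_*$ represented by a partially isometric multiplier $\Theta\in\mathcal{M}(H^2_n\otimes\mathcal{E},\mathcal{H}_K\otimes\mathcal{E}_* )$, where $\mathcal{E}$ is a Hilbert space. Then $\Theta_0:\mathbb{B}^n\to\mathcal{B}(\mathcal{F},\mathcal{E}_* )$, $\Theta_0(z)=\Theta(z)|_{\mathcal{F}}$, where $$\mathcal{F}=\{\eta\in\mathcal{E}:M_\Theta^*M_\Theta\eta=\eta\},$$ defines a $K$-inner function such that the wandering subspace $\mathcal{W}=\mathcal{S}\ominus\sum_{i=1}^nM_{z_i}\mathcal{S}$ of $M_z$ restricted to $\mathcal{S}$ is given by $$\mathcal{W}=\Theta_0\mathcal{F}.$$ The wandering subspace $\mathcal{W}$ is generating for $M_z|_{\mathcal{S}}$ if and only if $$\mathcal{S}=\overline{\Theta H^2_n(\mathcal{F})}.$$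
   Context: All Hilbert spaces are complex; $\mathbb{N}$ contains $0$; $\mathbb{B}^n$ is the open unit ball of $\mathbb{C}^n$. For a closed subspace $\mathcal{A}$ and a (not necessarily closed) linear subspace $\mathcal{L}\subset\mathcal{A}$, $\mathcal{A}\ominus\mathcal{L}$ denotes $\mathcal{A}\cap\mathcal{L}^\perp$. Let $K : \mathbb{B}^n\times\mathbb{B}^n\to\mathbb{C}$ be a positive definite function (i.e. a positive semidefinite kernel) and $\mathcal{H}_K$ the reproducing kernel Hilbert space with kernel $K$. $\mathcal{H}_K$ is a contractive analytic Hilbert space on $\mathbb{B}^n$ if it consists of analytic functions on $\mathbb{B}^n$ and the tuple $M_z=(M_{z_1},\ldots,M_{z_n})$ of multiplications by the coordinate functions is a (well-defined, bounded) pure row contraction on $\mathcal{H}_K$. Here a commuting tuple $T=(T_1,\dots,T_n)$ of bounded operators is a row contraction if $P_T(I)\le I$, where $P_T(X)=\sum_{i=1}^n T_iXT_i^*$, and it is pure if $P_T^m(I)\to 0$ strongly as $m\to\infty$. $\mathcal{H}_K\otimes\mathcal{E}_*$ is identified with the $\mathcal{E}_*$-valued reproducing kernel Hilbert space with kernel $K(z,w)I_{\mathcal{E}_*}$, and $M_z$ also denotes the tuple of multiplications by the coordinate functions on it. $H^2_n$ is the Drury-Arveson space, the reproducing kernel Hilbert space on $\mathbb{B}^n$ with kernel $(1-\sum_{i=1}^n z_i\bar w_i)^{-1}$, and $H^2_n(\mathcal{E})=H^2_n\otimes\mathcal{E}$ is its $\mathcal{E}$-valued version. $\mathcal{E}$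 is identified with the constant functions in $H^2_n(\mathcal{E})$; for a closed subspace $\mathcal{F}\subset\mathcal{E}$, $H^2_n(\mathcal{F})$ is regarded as a closed subspace of $H^2_n(\mathcal{E})$. $\mathcal{M}(H^2_n\otimes\mathcal{E},\mathcal{H}_K\otimes\mathcal{E}_* )$ is the set of $K$-multipliers: functions $\Theta:\mathbb{B}^n\to\mathcal{B}(\mathcal{E},\mathcal{E}_* )$ such that the pointwise product $\Theta f$ belongs to $\mathcal{H}_K\otimes\mathcal{E}_*$ for every $f\in H^2_n\otimes\mathcal{E}$. The multiplication operator $M_\Theta:f\mapsto\Theta f$ is then bounded; $\Theta$ is partially isometric if $M_\Theta$ is a partial isometry. A function $\Theta:\mathbb{B}^n\to\mathcal{B}(\mathcal{E},\mathcal{E}_* )$ is $K$-inner if for all $x\in\mathcal{E}$ the function $\Theta x:z\mapsto\Theta(z)x$ belongs to $\mathcal{H}_K\otimes\mathcal{E}_*$ with $\|\Theta x\|_{\mathcal{H}_K\otimes\mathcal{E}_*}=\|x\|_{\mathcal{E}}$, and $\Theta\mathcal{E}\perp M_z^{k}(\Theta\mathcal{E})$ for all $k\in\mathbb{N}^n\setminus\{0\}$, where $\Theta\mathcal{E}=\{\Theta x:x\in\mathcal{E}\}$. A closed subspace $\mathcal{W}$ of a Hilbert space $\mathcal{K}$ is a wandering subspace for a commuting tuple $R=(R_1,\dots,R_n)$ of bounded operators on $\mathcal{K}$ if $\mathcal{W}\perp R^k\mathcal{W}$ for all $k\in\mathbb{N}^n\setminus\{0\}$; it is generating if in addition $\mathcal{K}=\overline{\mathrm{span}}\{R^k\mathcal{W}:k\in\mathbb{N}^n\}$.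 *)

(* Defs.v *)
From HB Require Import structures.
From mathcomp Require Import all_boot all_order all_algebra.
From mathcomp Require Import all_classical all_reals.
From mathcomp Require Import topology normedtype sequences derive.
From mathcomp Require Import complex.

Set Implicit Arguments.
Unset Strict Implicit.
Unset Printing Implicit Defensive.

Import Order.TTheory GRing.Theory Num.Theory.
Import numFieldNormedType.Exports.

Local Open Scope classical_set_scope.
Local Open Scope ring_scope.

(* Complex Hilbert spaces; the inner product is linear in the first argument. *)
HB.mixin Record CompleteNormedModule_isHilbert (R : realType) V
    & CompleteNormedModule R[i] V := {
  hdot : V -> V -> R[i] ;
  hdot_linearl : forall (a : R[i]) (x y z : V),
    hdot (a *: x + y) z = a * hdot x z + hdot y z ;
  hdot_conj : forall x y : V, hdot x y = Num.conj (hdot y x) ;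
  hdot_norm : forall x : V, hdot x x = `|x| ^+ 2
}.

#[short(type="hilbertType")]
HB.structure Definition Hilbert (R : realType) :=
  {V of CompleteNormedModule R[i] V & CompleteNormedModule_isHilbert R V}.

Section HilbertDot.
Variables (R : realType) (H : hilbertType R).

Let hdot_linearr (x : H) (a : R[i]) (y z : H) :
  hdot x (a *: y + z) = Num.conj a * hdot x y + hdot x z.
Proof.
by rewrite hdot_conj hdot_linearl rmorphD rmorphM /= -!hdot_conj.
Qed.

Let hdotP : @bilinear_for R[i] H H R[i] *%R (Num.conj \; *%R) (@hdot R H).
Proof. by split=> u a x y; [exact: hdot_linearl|exact: hdot_linearr]. Qed.

HB.instance Definition _ :=
  bilinear_isBilinear.Build R[i] H H R[i] *%R (Num.conj \; *%R) (@hdot R H) hdotP.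

Let hdot_herm (x y : H) : hdot x y = (-1) ^+ false * Num.conj (hdot y x).
Proof. by rewrite expr0 mul1r hdot_conj. Qed.

HB.instance Definition _ :=
  isHermitianSesquilinear.Build R[i] H false Num.conj (@hdot R H) hdot_herm.

Let hdot_gt0 (x : H) : x != 0 -> 0 < hdot x x.
Proof. by move=> x0; rewrite hdot_norm exprn_gt0// normr_gt0. Qed.

HB.instance Definition _ := isDotProduct.Build R[i] H (@hdot R H) hdot_gt0.

End HilbertDot.

Section ComplexHilbert.
Variable R : realType.

Lemma normc_le_ReIm (z : R[i]) :
  `|z| <= (`|complex.Re z| + `|complex.Im z|)%:C%C.
Proof.
rewrite normc_def lecR -(@ler_pXn2r _ 2) ?nnegrE ?sqrtr_ge0 ?addr_ge0//.
rewrite sqr_sqrtr ?addr_ge0 ?sqr_ge0// sqrrD !real_normK ?num_real//.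
by rewrite lerD2r lerDl mulrn_wge0// mulr_ge0.
Qed.

Lemma normc_ge_Re' (z : R[i]) : (`|complex.Re z|)%:C%C <= `|z|.
Proof.
rewrite normc_def lecR -sqrtr_sqr ler_wsqrtr// lerDl sqr_ge0//.
Qed.

Lemma normc_ge_Im (z : R[i]) : (`|complex.Im z|)%:C%C <= `|z|.
Proof.
rewrite normc_def lecR -sqrtr_sqr ler_wsqrtr// lerDr sqr_ge0//.
Qed.

HB.instance Definition _ := isPointed.Build R[i] 0.
HB.instance Definition _ := NormedModule.copy R[i] R[i]^o.

Lemma complex_complete (F : set_system R[i]) :
  ProperFilter F -> cauchy F -> cvg F.
Proof.
move=> FF /cauchy_ballP FC.
have key (p : R[i] -> R) :
    (forall x y, (`|p x - p y|)%:C%C <= `|x - y|) -> cvg (p @ F).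
  move=> pl; apply: R_complete; apply/cauchy_ballP => e e0.
  have e0' : 0 < e%:C%C by rewrite ltcR.
  have [/= [A B] [FA FB] AB] := FC _ e0'.
  exists (p @` A, p @` B) => [|[_ _] [/= [x Ax <-] [y By <-]]].
    by split; [apply: filterS FA => x Ax|apply: filterS FB => x Ax]; exists x.
  rewrite /ball /= -ltcR; apply: le_lt_trans (pl _ _) _.
  exact: (AB (x, y)).
have /cvg_ex[a Ha] : cvg ((@complex.Re R) @ F).
  by apply: key => x y; rewrite -raddfB; exact: normc_ge_Re'.
have /cvg_ex[b Hb] : cvg ((@complex.Im R) @ F).
  by apply: key => x y; rewrite -raddfB; exact: normc_ge_Im.
apply/cvg_ex; exists (a +i* b)%C.
apply/cvgrPdist_lt => /= e e0.
have eE : e = (complex.Re e)%:C%C.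
  by case: e e0 => u v /=; rewrite ltcE /= => /andP[/eqP -> _].
have e2 : 0 < complex.Re e / 2.
  by rewrite divr_gt0// -ltcR -eE.
move/cvgrPdist_lt : Ha => /(_ _ e2) Ha; move/cvgrPdist_lt : Hb => /(_ _ e2) Hb.
near=> z.
apply: le_lt_trans (normc_le_ReIm _) _.
rewrite eE ltcR [ltRHS]splitr !raddfB /= ltrD//.
  by near: z; exact: Ha.
by near: z; exact: Hb.
Unshelve. all: by end_near. Qed.

HB.instance Definition _ := Uniform_isComplete.Build R[i] complex_complete.

Let cdot (x y : R[i]) : R[i] := x * Num.conj y.

Let cdot_linearl (a x y z : R[i]) : cdot (a *: x + y) z = a * cdot x z + cdot y z.
Proof. by rewrite /cdot mulrDl -mulrA. Qed.

Let cdot_conj (x y : R[i]) : cdot x y = Num.conj (cdot y x).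
Proof. by rewrite /cdot rmorphM /= conjCK mulrC. Qed.

Let cdot_norm (x : R[i]) : cdot x x = `|x| ^+ 2.
Proof. by rewrite /cdot -normCK. Qed.

HB.instance Definition _ := CompleteNormedModule_isHilbert.Build R R[i]
  cdot_linearl cdot_conj cdot_norm.
End ComplexHilbert.

Definition is_subspace (R : realType) (H : hilbertType R) (A : set H) :=
  A 0 /\ forall (a : R[i]) x y, A x -> A y -> A (a *: x + y).

Record closedSubspace (R : realType) (H : hilbertType R) := ClosedSubspace {
  cs_set :> set H ;
  cs_subspace : is_subspace cs_set ;
  cs_closed : closed cs_set
}.

Section SubspaceHilbert.
Variables (R : realType) (H : hilbertType R) (A : closedSubspace H).

Definition cs_pred : {pred H} := fun x => `[< cs_set A x >].

Record subspaceType := SubspaceElt { cs_val :> H ; _ : cs_pred cs_val }.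

Let cs_submod : submod_closed cs_pred.
Proof.
have [A0 AD] := cs_subspace A.
split; first exact/asboolP.
by move=> a x y /asboolP Ax /asboolP Ay; apply/asboolP; exact: AD.
Qed.

HB.instance Definition _ := [isSub for cs_val].
HB.instance Definition _ := [Choice of subspaceType by <:].
HB.instance Definition _ :=
  GRing.SubChoice_isSubLmodule.Build R[i] H cs_pred subspaceType cs_submod.

Let sub_norm (x : subspaceType) : R[i] := `|cs_val x|.

Let sub_norm_triangle (x y : subspaceType) :
  sub_norm (x + y) <= sub_norm x + sub_norm y.
Proof. exact: ler_normD. Qed.

Let sub_normZ (a : R[i]) (x : subspaceType) :
  sub_norm (a *: x) = `|a| * sub_norm x.
Proof. exact: normrZ. Qed.

Let sub_norm0 (x : subspaceType) : sub_norm x = 0 -> x = 0.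
Proof. by move=> /normr0_eq0 x0; apply: val_inj. Qed.

HB.instance Definition _ := Lmodule_isNormed.Build R[i] subspaceType
  sub_norm_triangle sub_normZ sub_norm0.

Lemma cs_val_norm (x : subspaceType) : `|cs_val x| = `|x|.
Proof. by []. Qed.

Lemma cs_valP (x : subspaceType) : cs_set A (cs_val x).
Proof. by case: x => x /= /asboolP. Qed.

Let sub_complete (F : set_system subspaceType) :
  ProperFilter F -> cauchy F -> cvg F.
Proof.
move=> FF /cauchy_ballP FC.
have : cvg (cs_val @ F).
  apply: cauchy_cvg; apply/cauchy_ballP => e e0.
  have [/= [P Q] [FP FQ] PQ] := FC _ e0.
  exists (cs_val @` P, cs_val @` Q) => [|[_ _] [/= [x Px <-] [y Qy <-]]].
    by split; [apply: filterS FP => x Px|apply: filterS FQ => x Qx]; exists x.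
  by have := PQ (x, y) (conj Px Qy); rewrite /= -!ball_normE.
move=> /cvg_ex[l Fl].
have Al : cs_set A l.
  have nA : \forall x \near F, cs_set A (cs_val x) by apply: nearW => x; exact: cs_valP.
  exact: (@closed_cvg _ H F _ cs_val (cs_set A) (cs_closed (c := A)) nA l Fl).
apply/cvg_ex; exists (SubspaceElt (asboolT Al)).
apply/cvgrPdist_lt => e e0; move/cvgrPdist_lt : Fl => /(_ _ e0).
by apply: filterS => x; rewrite -cs_val_norm.
Qed.

HB.instance Definition _ := Uniform_isComplete.Build subspaceType sub_complete.

Let sub_dot (x y : subspaceType) : R[i] := hdot (cs_val x) (cs_val y).

Let sub_dot_linearl (a : R[i]) (x y z : subspaceType) :
  sub_dot (a *: x + y) z = a * sub_dot x z + sub_dot y z.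
Proof. exact: hdot_linearl. Qed.

Let sub_dot_conj (x y : subspaceType) : sub_dot x y = Num.conj (sub_dot y x).
Proof. exact: hdot_conj. Qed.

Let sub_dot_norm (x : subspaceType) : sub_dot x x = `|x| ^+ 2.
Proof. exact: hdot_norm. Qed.

HB.instance Definition _ := CompleteNormedModule_isHilbert.Build R subspaceType
  sub_dot_linearl sub_dot_conj sub_dot_norm.

End SubspaceHilbert.

Section Operators.
Variable R : realType.

Record boundedOp (U V : hilbertType R) := BoundedOp {
  bop_fun :> {linear U -> V} ;
  bop_continuous : continuous bop_fun
}.

Lemma cs_val_continuous (H : hilbertType R) (A : closedSubspace H) :
  continuous (@cs_val R H A).
Proof.
move=> x; apply/(cvgrPdist_lt (FF := nbhs_filter x)) => e e0.
apply/nbhs_ballP; exists e => //= y; rewrite -ball_normE.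
Qed.

Let bop_restr_continuous (U V : hilbertType R) (T : boundedOp U V)
  (F : closedSubspace U) :
  continuous ((T \o (\val : subspaceType F -> U)) : {linear _ -> _}).
Proof.
move=> x; apply: continuous_comp; first exact: cs_val_continuous.
exact: bop_continuous.
Qed.

Definition bop_restr (U V : hilbertType R) (T : boundedOp U V)
    (F : closedSubspace U) : boundedOp (subspaceType F) V :=
  BoundedOp (@bop_restr_continuous U V T F).

Definition is_bounded_op (U V : hilbertType R) (T : U -> V) :=
  linear T /\ continuous T.

(* The value of [adjoint T] at y is the vector representing h |-> <T h, y>,
   which exists (and is unique) as soon as T is linear and bounded. *)
Definition adjoint (U V : hilbertType R) (T : U -> V) (y : V) : U :=
  xget 0 [set x : U | forall h : U, hdot (T h) y = hdot h x].

Definition orthogonal_set (H : hilbertType R) (L : set H) : set H :=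
  [set x | forall y, L y -> hdot x y = 0].

Definition ominus (H : hilbertType R) (A L : set H) : set H :=
  A `&` orthogonal_set L.

Definition orthogonal_sets (H : hilbertType R) (A B : set H) :=
  forall x y, A x -> B y -> hdot x y = 0.

Definition linear_span (H : hilbertType R) (A : set H) : set H :=
  [set x | exists m (c : 'I_m -> R[i]) (v : 'I_m -> H),
     (forall j, A (v j)) /\ x = \sum_(j < m) c j *: v j].

Definition closed_span (H : hilbertType R) (A : set H) : set H :=
  closure (linear_span A).

Definition partial_isometry (U V : hilbertType R) (T : U -> V) :=
  forall x, orthogonal_set [set y | T y = 0] x -> `|T x| = `|x|.

Section Tuples.
Variables (n : nat) (H : hilbertType R).
Implicit Types (T : 'I_n -> H -> H) (k : 'I_n -> nat).

Definition commuting T := forall i j x, T i (T j x) = T j (T i x).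

Definition tuple_pow T k : H -> H :=
  \big[(fun f g => f \o g)/id]_(i < n) iter (k i) (T i).

Definition op_P T (X : H -> H) : H -> H :=
  fun h => \sum_(i < n) T i (X (adjoint (T i) h)).

Definition row_contraction T :=
  [/\ forall i, is_bounded_op (T i), commuting T &
      forall h, hdot (op_P T id h) h <= hdot h h].

Definition pure T :=
  forall h, (fun m => iter m (op_P T) id h) @ \oo --> (0 : H).

Definition wandering T (W : set H) :=
  [/\ is_subspace W, closed W &
      forall k, (exists i, k i != 0%N) ->
        orthogonal_sets W (tuple_pow T k @` W)].

Definition generating T (W : set H) :=
  wandering T W /\
  [set: H] = closed_span (\bigcup_(k in [set: 'I_n -> nat]) (tuple_pow T k @` W)).

Definition invariant_under T (S : set H) := forall i x, S x -> S (T i x).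

Let restrict_subproof T (S : closedSubspace H) (TS : invariant_under T (cs_set S)) i
  (x : subspaceType S) : cs_pred S (T i (cs_val x)).
Proof. by apply/asboolP; apply: TS; exact: cs_valP. Qed.

Definition tuple_restrict T (S : closedSubspace H) (TS : invariant_under T (cs_set S)) :
    'I_n -> subspaceType S -> subspaceType S :=
  fun i x => SubspaceElt (restrict_subproof TS i x).

Definition tuple_range_sum T (S : set H) : set H :=
  [set x | exists f : 'I_n -> H, (forall i, S (f i)) /\ x = \sum_(i < n) T i (f i)].

End Tuples.

(* [rkhs k E] is the type of Hilbert spaces of E-valued functions on X (via
   [ev]) with reproducing kernel k(z, w) I_E. They are unique up to the unitary
   that preserves function values, and (for k positive definite) they realize the
   tensor product of the scalar space with kernel k and E. *)
Record rkhs (X : Type) (k : X -> X -> R[i]) (E : hilbertType R) := Rkhs {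
  rkhs_sort :> hilbertType R ;
  ev : rkhs_sort -> X -> E ;
  ev_linear : forall z, linear (ev ^~ z) ;
  ev_inj : forall f g, ev f =1 ev g -> f = g ;
  ev_kernel : forall w x, exists kwx : rkhs_sort,
    (forall z, ev kwx z = k z w *: x) /\
    forall f, hdot f kwx = hdot (ev f w) x
}.

Definition positive_definite (X : Type) (k : X -> X -> R[i]) :=
  forall m (z : 'I_m -> X) (c : 'I_m -> R[i]),
    0 <= \sum_(i < m) \sum_(j < m) Num.conj (c i) * c j * k (z i) (z j).

Section Multipliers.
Variables (X : Type) (k1 k2 : X -> X -> R[i]) (E1 E2 : hilbertType R).
Variables (H1 : rkhs k1 E1) (H2 : rkhs k2 E2).

Definition is_product (phi : X -> E1 -> E2) (f : H1) (g : H2) :=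
  forall z, ev g z = phi z (ev f z).

Definition multiplier (phi : X -> E1 -> E2) :=
  forall f, exists g, is_product phi f g.

(* When phi is a multiplier, [mulop phi f] is the product of phi and f, which is
   unique by [ev_inj]. *)
Definition mulop (phi : X -> E1 -> E2) (f : H1) : H2 :=
  xget 0 [set g | is_product phi f g].

End Multipliers.

Arguments mulop {X k1 k2 E1 E2} H1 H2 phi f.
Arguments multiplier {X k1 k2 E1 E2} H1 H2 phi.

Definition const_fun (X : Type) (k : X -> X -> R[i]) (E : hilbertType R)
  (H : rkhs k E) (x : E) : H := xget 0 [set f : H | forall z, ev f z = x].

Section Ball.
Variable n : nat.

Definition unit_ball :=
  {z : 'rV[R[i]]_n | \sum_(i < n) `|z ord0 i| ^+ 2 < 1}.

(* The ball is open, so differentiability at its points does not depend on the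
   extension by 0; it is complex (Frechet) differentiability. *)
Definition analytic (f : unit_ball -> R[i]) :=
  forall z : unit_ball,
    differentiable (fun w : 'rV[R[i]]_n =>
      if insub w is Some u then f u else 0) (val z).

Definition drury_arveson_kernel (z w : unit_ball) : R[i] :=
  (1 - \sum_(i < n) val z ord0 i * Num.conj (val w ord0 i))^-1.

Definition coordinate (E : hilbertType R) (i : 'I_n) (z : unit_ball) (x : E) : E :=
  val z ord0 i *: x.

Definition Mz (K : unit_ball -> unit_ball -> R[i]) (E : hilbertType R)
    (H : rkhs K E) (i : 'I_n) : H -> H := mulop H H (@coordinate E i).

Arguments Mz {K E} H i f.

Definition contractive_analytic (K : unit_ball -> unit_ball -> R[i])
    (HK : rkhs K R[i]) :=
  [/\ forall f : HK, analytic (ev f),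
      forall i, multiplier HK HK (@coordinate R[i] i),
      row_contraction (Mz HK) & pure (Mz HK)].

Section KInner.
Variables (K : unit_ball -> unit_ball -> R[i]) (E Es : hilbertType R).
Variables (HKE : rkhs K Es) (Theta : unit_ball -> boundedOp E Es).

Definition range_const : set HKE :=
  [set g | exists x : E, forall z, ev g z = Theta z x].

Definition K_inner :=
  (forall x : E, exists g : HKE, (forall z, ev g z = Theta z x) /\ `|g| = `|x|) /\
  forall k : 'I_n -> nat, (exists i, k i != 0%N) ->
    orthogonal_sets range_const (tuple_pow (Mz HKE) k @` range_const).

End KInner.

Arguments range_const {K E Es} HKE Theta.
Arguments K_inner {K E Es} HKE Theta.

(* H(F) regarded as a subspace of H(E), for F a closed subspace of E. *)
Definition subspace_embedding (k : unit_ball -> unit_ball -> R[i])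
    (E : hilbertType R) (F : closedSubspace E) (H : rkhs k E)
    (HF : rkhs k (subspaceType F)) : set H :=
  [set f | exists g : HF, forall z, ev f z = cs_val (ev g z)].

End Ball.
End Operators.

Arguments mulop {R X k1 k2 E1 E2} H1 H2 phi f.
Arguments multiplier {R X k1 k2 E1 E2} H1 H2 phi.
Arguments Mz {R n K E} H i f.
Arguments drury_arveson_kernel R n z w : clear implicits.
Arguments subspace_embedding {R n k E F} H HF.
Arguments range_const {R n K E Es} HKE Theta.
Arguments K_inner {R n K E Es} HKE Theta.

(* Main.v *)
(** Let [M] be multiplication by [Theta].  It intertwines the coordinate shifts
    and is isometric on the orthogonal complement of its kernel, so a vector
    [M f] with [f] orthogonal to [ker M] lies in [W] iff [f] is orthogonal to all
    [z_i g].  In the Drury-Arveson space [k_w x = x + sum_i conj(w_i) z_i k_w x],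
    and therefore only the constants are orthogonal to all [z_i g]; this gives
    [W = M F], where [F] consists of the constants orthogonal to [ker M].

    For the last claim one needs that the [F]-valued functions are the closed
    span of the [z^k eta], [eta] in [F].  If [q] is the component of [k_w eta]
    orthogonal to that span, the same identity gives [|q|^2 = <A q, q>] for the
    multiplication [A] by [z |-> <z, w>], whose norm is at most [|w| < 1]; hence
    [q = 0]. *)
Require Import Defs.
From HB Require Import structures.
From mathcomp Require Import all_boot all_order all_algebra.
From mathcomp Require Import all_classical all_reals.
From mathcomp Require Import topology normedtype sequences derive.
From mathcomp Require Import complex ring.

Set Implicit Arguments.
Unset Strict Implicit.
Unset Printing Implicit Defensive.

Import Order.TTheory GRing.Theory Num.Theory.
Import numFieldNormedType.Exports.

Local Open Scope classical_set_scope.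
Local Open Scope ring_scope.

(** * Inner product algebra and the Cauchy-Schwarz inequality *)

Section HilbertGeometry.
Variables (R : realType) (H : hilbertType R).
Implicit Types (x y z u : H) (a c : R[i]).

Lemma hdotDl x y z : hdot (x + y) z = hdot x z + hdot y z.
Proof. exact: linearDl. Qed.

Lemma hdotDr z x y : hdot z (x + y) = hdot z x + hdot z y.
Proof. exact: linearDr. Qed.

Lemma hdotBl x y z : hdot (x - y) z = hdot x z - hdot y z.
Proof. exact: linearBl. Qed.

Lemma hdotBr z x y : hdot z (x - y) = hdot z x - hdot z y.
Proof. exact: linearBr. Qed.

Lemma hdotZl a x z : hdot (a *: x) z = a * hdot x z.
Proof. exact: linearZl_LR. Qed.

Lemma hdotZr a z x : hdot z (a *: x) = Num.conj a * hdot z x.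
Proof. exact: linearZr_LR. Qed.

Lemma hdot0l z : hdot 0 z = 0.
Proof. exact: linear0l. Qed.

Lemma hdot0r z : hdot z 0 = 0.
Proof. exact: linear0r. Qed.

Lemma hdot_suml (I : Type) (r : seq I) (P : pred I) (F : I -> H) z :
  hdot (\sum_(i <- r | P i) F i) z = \sum_(i <- r | P i) hdot (F i) z.
Proof. exact: (big_morph (fun x => hdot x z) (fun x y => hdotDl x y z) (hdot0l z)). Qed.

Lemma hdot_sumr (I : Type) (r : seq I) (P : pred I) (F : I -> H) z :
  hdot z (\sum_(i <- r | P i) F i) = \sum_(i <- r | P i) hdot z (F i).
Proof. exact: (big_morph (hdot z) (hdotDr z) (hdot0r z)). Qed.

Lemma hdot_eq0 x : hdot x x = 0 -> x = 0.
Proof. by rewrite hdot_norm => /eqP; rewrite sqrf_eq0 normr_eq0 => /eqP. Qed.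

Lemma hdot_sym0 x y : hdot x y = 0 -> hdot y x = 0.
Proof. by move=> xy; rewrite hdot_conj xy rmorph0. Qed.

Lemma norm2DZ a x y : `|x + a *: y| ^+ 2 =
  `|x| ^+ 2 + (a * hdot y x + Num.conj (a * hdot y x)) + `|a| ^+ 2 * `|y| ^+ 2.
Proof.
rewrite -(hdot_norm (x + _)) -(hdot_norm x) -(hdot_norm y) hdotDl !hdotDr.
by rewrite !hdotZl !hdotZr (hdot_conj x y) normCK rmorphM /=; ring.
Qed.

(* The minimum of [2 Re (a s) + |a|^2 |y|^2] over [a]. *)
Lemma norm2DZ_min x y (s : R[i]) : y != 0 ->
  let a := - (Num.conj s / `|y| ^+ 2) in
  a * s + Num.conj (a * s) + `|a| ^+ 2 * `|y| ^+ 2 = - (`|s| ^+ 2 / `|y| ^+ 2).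
Proof.
move=> y0 a; have ny0 : `|y| ^+ 2 != 0 by rewrite sqrf_eq0 normr_eq0.
have as_ : a * s = - (`|s| ^+ 2 / `|y| ^+ 2).
  by rewrite /a normCK mulNr mulrAC [s * _]mulrC.
have -> : Num.conj (a * s) = a * s.
  by rewrite as_; apply/CrealP; rewrite rpredN rpred_div ?rpredX ?normr_real.
rewrite as_ /a normrN normrM norm_conjC normfV normrX normr_id exprMn exprVn.
have -> : `|s| ^+ 2 * (`|y| ^+ 2) ^- 2 * `|y| ^+ 2 = `|s| ^+ 2 / `|y| ^+ 2.
  by rewrite [(`|y| ^+ 2) ^+ 2]expr2 invfM -mulrA divfK.
ring.
Qed.

Lemma norm_hdot_le x y : `|hdot x y| <= `|x| * `|y|.
Proof.
have [->|y0] := eqVneq y 0; first by rewrite hdot0r !normr0 mulr0.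
have ny0 : 0 < `|y| ^+ 2 by rewrite exprn_gt0 ?normr_gt0.
(* The coefficient is the minimizing one of [norm2DZ_min]; nonnegativity at the minimum is the
   inequality. *)
have H0 : 0 <= `|x + - (Num.conj (hdot y x) / `|y| ^+ 2) *: y| ^+ 2.
  by rewrite exprn_ge0.
move: H0; rewrite norm2DZ -addrA norm2DZ_min//.
rewrite subr_ge0 ler_pdivrMr// -exprMn ler_pXn2r ?nnegrE ?mulr_ge0//.
by rewrite hdot_conj norm_conjC.
Qed.

End HilbertGeometry.

(** * Continuity of bounded linear maps and closedness of zero sets *)

Section Continuity.
Variable R : realType.

Lemma lipschitz_linear_continuous (U V : hilbertType R) (f : U -> V) (M : R[i]) :
  linear f -> (forall x, `|f x| <= M * `|x|) -> continuous f.
Proof.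
move=> fl fM.
(* [M] is a complex scalar; the bound at a nonzero vector forces it to be real and nonnegative, and
   on the zero space any real bound will do. *)
have M_real : M \is Num.real \/ forall x : U, x = 0.
  have [|/existsNP[x /eqP x0]] := pselect (forall x : U, x = 0); [by right|left].
  apply: ger0_real; rewrite -(@pmulr_lge0 _ `|x|) ?normr_gt0//.
  exact: le_trans (fM x).
pose g : {linear U -> V} := HB.pack f (GRing.isLinear.Build _ _ _ _ _ fl).
apply: (@bounded_linear_continuous _ _ _ g); apply/linear_boundedP.
case: M_real => [Mr|U0]; last first.
  by apply: nearW => r x; rewrite (U0 x) linear0 !normr0 mulr0.
apply: filterS (nbhs_pinfty_ge Mr) => r Mr' x.
by apply: le_trans (fM x) _; rewrite ler_wpM2r.
Qed.

Lemma hdotl_continuous (H : hilbertType R) (z : H) : continuous (fun x => hdot x z).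
Proof.
apply: (@lipschitz_linear_continuous H R[i] _ `|z|) => [a x y|x].
  exact: hdot_linearl.
by rewrite mulrC; exact: norm_hdot_le.
Qed.

Lemma hdotr_continuous (H : hilbertType R) (z : H) : continuous (hdot z).
Proof.
move=> x; apply/(cvgrPdist_lt (FF := nbhs_filter x)) => e e0.
have /(cvgrPdist_lt (FF := nbhs_filter x))/(_ _ e0) := @hdotl_continuous H z x.
by apply: filterS => y; rewrite (hdot_conj z x) (hdot_conj z y) -rmorphB norm_conjC.
Qed.

Lemma closed_preimage_hilbert (U V : hilbertType R) (f : U -> V) (A : set V) :
  continuous f -> closed A -> closed [set x | A (f x)].
Proof. by move=> cf cA; apply: (preimage_closed _ cA) => x _; exact: cf. Qed.

Lemma closed_zero_set (U V : hilbertType R) (f : U -> V) :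
  continuous f -> closed [set x | f x = 0].
Proof.
move=> cf; apply: (closed_preimage_hilbert cf (A := [set 0])).
exact/accessible_closed_set1/hausdorff_accessible/norm_hausdorff.
Qed.

Lemma closed_orthogonal_set (H : hilbertType R) (A : set H) : closed (orthogonal_set A).
Proof.
have -> : orthogonal_set A = \bigcap_(y in A) [set x | hdot x y = 0] by [].
apply: closed_bigI => y _.
exact: (closed_zero_set (V := R[i]) (@hdotl_continuous H y)).
Qed.

End Continuity.

(** * Riesz representation and orthogonal projection *)

Section Riesz.
Variables (R : realType) (H : hilbertType R).

Lemma inv_nat_lt (e : R[i]) : 0 < e ->
  exists N : nat, forall k, (N <= k)%N -> (k.+1%:R^-1)%:C%C < e.
Proof.
move=> e0; have eE : e = (complex.Re e)%:C%C by rewrite RRe_real// gtr0_real.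
have r0 : 0 < complex.Re e by rewrite -ltcR -eE.
exists (Num.bound (complex.Re e)^-1) => k Nk; rewrite eE ltcR.
rewrite invf_plt ?posrE//; apply: lt_le_trans (archi_boundP _) _.
  by rewrite invr_ge0 ltW.
by rewrite ler_nat ltnW.
Qed.

(* [G] is the graph of a bounded linear functional on a subspace; keeping it a
   relation spares a choice of representatives in the applications.  The
   representing vector is the limit of a minimizing sequence of
   [|h|^2 - 2 Re c] over the graph. *)
Lemma riesz_graph (G : H -> R[i] -> Prop) (C : R[i]) : 0 <= C ->
  G 0 0 ->
  (forall a h c g d, G h c -> G g d -> G (a *: h + g) (a * c + d)) ->
  (forall h c, G h c -> `|c| <= C * `|h|) ->
  exists u, [/\ forall h c, G h c -> hdot h u = c,
                closure [set h | exists c, G h c] u & `|u| <= C].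
Proof.
move=> C0 G00 GL GC.
pose Q (h : H) (c : R[i]) := `|h| ^+ 2 - (c + Num.conj c).
have re2 (c : R[i]) : c + Num.conj c \is Num.real.
  by apply/CrealP; rewrite rmorphD /= conjCK addrC.
(* Bounding [c] by [C * |h|] leaves [|h|^2 - 2 C |h|], and completing the square gives the lower
   bound. *)
have Q_ge h c : G h c -> - C ^+ 2 <= Q h c.
  move=> Ghc; rewrite lerNl /Q opprB lerBlDr.
  apply: le_trans (real_ler_norm (re2 c)) _; apply: le_trans (ler_normD _ _) _.
  rewrite norm_conjC.
  apply: (@le_trans _ _ (C * `|h| + C * `|h|)); first by rewrite lerD ?GC.
  rewrite -subr_ge0.
  have -> : C ^+ 2 + `|h| ^+ 2 - (C * `|h| + C * `|h|) = (C - `|h|) ^+ 2 by ring.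
  by rewrite real_exprn_even_ge0// rpredB ?normr_real ?ger0_real.
have Q_real h c : exists r : R, Q h c = r%:C%C.
  by apply/complex_realP; rewrite rpredB ?rpredX ?normr_real.
have [c0 c0E] : exists r : R, - C ^+ 2 = r%:C%C.
  by apply/complex_realP; rewrite rpredN rpredX ?ger0_real.
pose E := [set r : R | exists h c, G h c /\ Q h c = r%:C%C].
have E_inf : has_inf E.
  split.
    by have [r Qr] := Q_real 0 0; exists r, 0, 0.
  exists c0 => r [h [c [Ghc Qhc]]].
  by have := Q_ge _ _ Ghc; rewrite Qhc c0E lecR.
have Q_inf h c : G h c -> (inf E)%:C%C <= Q h c.
  move=> Ghc; have [r Qr] := Q_real h c; rewrite Qr lecR.
  by apply: ge_inf; [case: E_inf|exists h, c].
(* If [Q] is within [e^2] of its infimum at [p], the best perturbation of [p] along [g] can lower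
   [Q] by at most [e^2]; that decrease is the squared error at [g] divided by [|g|^2]. *)
have approx (e : R) : 0 < e -> exists p : H * R[i], G p.1 p.2 /\
    forall g d, G g d -> `|hdot g p.1 - d| <= e%:C%C * `|g|.
  move=> e0; have e2 : 0 < e ^+ 2 by rewrite exprn_gt0.
  have [r [h [c [Ghc Qhc]]] rE] := inf_adherent e2 E_inf.
  exists (h, c); split=> //= g d Ggd.
  have [g0|g0] := eqVneq g 0.
    by have := GC _ _ Ggd; rewrite g0 hdot0l sub0r normrN normr0 !mulr0.
  have ng0 : 0 < `|g| ^+ 2 by rewrite exprn_gt0 ?normr_gt0.
  set s := _ - d.
  have eg0 : 0 <= e%:C%C * `|g| by rewrite mulr_ge0// ler0c ltW.
  suff : `|s| ^+ 2 <= (e%:C%C * `|g|) ^+ 2 by rewrite ler_pXn2r ?nnegrE.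
  rewrite exprMn -ler_pdivrMr//.
  pose a := - (Num.conj s / `|g| ^+ 2).
  have GLa : G (a *: g + h) (a * d + c) by exact: GL.
  have := Q_inf _ _ GLa.
  have -> : Q (a *: g + h) (a * d + c) = Q h c - `|s| ^+ 2 / `|g| ^+ 2.
    rewrite -norm2DZ_min// -/a /Q [_ *: g + h]addrC norm2DZ /s mulrBr rmorphB rmorphD /=.
    ring.
  rewrite -(lerD2r (`|s| ^+ 2 / `|g| ^+ 2)) subrK => sQ.
  have : Q h c <= (inf E)%:C%C + e%:C%C ^+ 2.
    by rewrite Qhc -rmorphXn -rmorphD lecR ltW.
  by move=> /(le_trans sQ); rewrite lerD2l.
have inv_gt0 (k : nat) : 0 < (k.+1%:R^-1 : R) by rewrite invr_gt0.
have [p /all_and2[Gp pP]] := choice (fun k => approx _ (inv_gt0 k)).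
(* Testing both near-minimizers on their own difference [g] writes [|g|^2] as a difference of two
   errors. *)
have p_diff k l : `|(p k).1 - (p l).1| <= (k.+1%:R^-1)%:C%C + (l.+1%:R^-1)%:C%C.
  set g := _ - _; have [->|g0] := eqVneq g 0.
    by rewrite normr0 addr_ge0// ler0c ltW.
  have Gg : G g ((p k).2 - (p l).2).
    have := GL (-1) _ _ _ _ (Gp l) (Gp k).
    by rewrite scaleN1r mulN1r ![- _ + _]addrC.
  rewrite -(@ler_pM2r _ `|g|) ?normr_gt0// -expr2 mulrDl.
  have -> : `|g| ^+ 2 = `|hdot g (p k).1 - ((p k).2 - (p l).2) -
                         (hdot g (p l).1 - ((p k).2 - (p l).2))|.
    have -> : forall A B D : R[i], A - D - (B - D) = A - B by move=> *; ring.
    by rewrite -hdotBr hdot_norm ger0_norm// exprn_ge0.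
  by apply: le_trans (ler_normB _ _) _; rewrite lerD ?pP.
have : cvg ((fun k => (p k).1) @ \oo).
  apply: cauchy_cvg; apply: cauchy_exP => e e0.
  have e2 : 0 < e / 2 by rewrite divr_gt0.
  have [N HN] := inv_nat_lt e2.
  exists (p N).1; exists N => //= k Nk; rewrite -ball_normE /=.
  apply: le_lt_trans (p_diff _ _) _; rewrite [ltRHS]splitr ltrD// HN//.
move=> /cvg_ex[u pu].
have Hu h c : G h c -> hdot h u = c.
  move=> Ghc.
  have c1 : (fun k => hdot h (p k).1) @ \oo --> hdot h u.
    exact: (cvg_comp _ _ pu (@hdotr_continuous _ _ _ _)).
  have c2 : (fun k => hdot h (p k).1) @ \oo --> c.
    apply/cvgrPdist_lt => e e0.
    have h1 : 0 < `|h| + 1 by rewrite ltr_wpDl.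
    have [N HN] := inv_nat_lt (divr_gt0 e0 h1).
    exists N => //= k /HN; rewrite distrC ltr_pdivlMr// => ke.
    apply: le_lt_trans (pP _ _ _ Ghc) _; apply: le_lt_trans ke.
    by apply: ler_wpM2l; [rewrite ler0c ltW|rewrite lerDl].
  exact: cvg_unique c1 c2.
have Cu : closure [set h | exists c, G h c] u.
  move=> B /pu [N _ BN]; exists (p N).1; split; first by exists (p N).2.
  by apply: BN => /=.
exists u; split=> //.
have [->|u0] := eqVneq u 0; first by rewrite normr0.
rewrite -(@ler_pM2r _ `|u|) ?normr_gt0//.
(* The bound [C] holds only on the domain of the graph, so [u] is replaced in one slot of [<u, u>]
   by a nearby domain vector [g]. *)
apply/ler_addgt0Pr => e e0.
have uC : 0 < `|u| + C by rewrite ltr_pwDl ?normr_gt0.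
have [g [[c Ggc] ]] := Cu _ (nbhsx_ballx u _ (divr_gt0 e0 uC)).
rewrite -ball_normE /= ltr_pdivlMr// => ug.
have -> : `|u| * `|u| = `|hdot (u - g) u + c|.
  by rewrite -(Hu _ _ Ggc) -hdotDl subrK hdot_norm -expr2 ger0_norm ?exprn_ge0.
apply: le_trans (ler_normD _ _) _.
apply: (@le_trans _ _ (`|u - g| * `|u| + C * (`|u - g| + `|u|))).
  rewrite lerD ?norm_hdot_le//; apply: le_trans (GC _ _ Ggc) _.
  by apply: ler_wpM2l => //; have := ler_normB u (u - g); rewrite subKr addrC.
have -> : `|u - g| * `|u| + C * (`|u - g| + `|u|) =
    C * `|u| + `|u - g| * (`|u| + C) by ring.
by rewrite lerD2l ltW.
Qed.

(** The vector representing [<., f>] restricted to [L] is the projection of [f] onto the closure of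
    [L]. *)
Lemma orthogonal_decomposition (L : set H) (f : H) : is_subspace L ->
  exists u v, [/\ f = u + v, closure L u & orthogonal_set L v].
Proof.
move=> [L0 LL].
have [||||u [uP Lu _]] :=
  @riesz_graph (fun h c => L h /\ c = hdot h f) `|f|.
- by [].
- by split=> //; rewrite hdot0l.
- move=> a h c g d [Lh ->] [Lg ->]; split; first exact: LL.
  by rewrite hdotDl hdotZl.
- by move=> h c [_ ->]; rewrite mulrC norm_hdot_le.
exists u, (f - u); split; first by rewrite addrC subrK.
  by apply: closure_subset Lu => h [c []].
move=> y Ly; apply: hdot_sym0; rewrite hdotBr (uP y (hdot y f))//.
by rewrite subrr.
Qed.

End Riesz.

(** * Evaluation and kernel functions in a reproducing kernel space *)

Section Rkhs.
Variables (R : realType) (X : Type) (k : X -> X -> R[i]) (E : hilbertType R).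
Variable H : rkhs k E.
Implicit Types (f g : H) (z w : X) (x y : E).

Lemma evD f g z : ev (f + g) z = ev f z + ev g z.
Proof. by have := ev_linear (r := H) z 1 f g; rewrite !scale1r. Qed.

Lemma ev0 z : ev (0 : H) z = 0.
Proof. by apply: (addrI (ev (0 : H) z)); rewrite -evD !addr0. Qed.

Lemma evZ (a : R[i]) f z : ev (a *: f) z = a *: ev f z.
Proof. by have := ev_linear (r := H) z a f 0; rewrite !addr0 ev0 addr0. Qed.

Lemma ev_sum (I : Type) (r : seq I) (P : pred I) (F : I -> H) z :
  ev (\sum_(i <- r | P i) F i) z = \sum_(i <- r | P i) ev (F i) z.
Proof. exact: (big_morph (fun f => ev f z) (fun f g => evD f g z) (ev0 z)). Qed.

Definition kernel_fun w x : H := sval (cid (ev_kernel H w x)).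

Lemma ev_kernel_fun w x z : ev (kernel_fun w x) z = k z w *: x.
Proof. by rewrite /kernel_fun; case: cid => f [/= fE _]; rewrite fE. Qed.

Lemma hdot_kernel_fun f w x : hdot f (kernel_fun w x) = hdot (ev f w) x.
Proof. by rewrite /kernel_fun; case: cid => g [/= _ gE]; rewrite gE. Qed.

Lemma kernel_funZ (a : R[i]) w x : kernel_fun w (a *: x) = a *: kernel_fun w x.
Proof. by apply: ev_inj => z; rewrite evZ !ev_kernel_fun scalerA mulrC -scalerA. Qed.

(** Pairing [f] with the kernel function at [z] in the direction [ev f z] gives [|ev f z|^2], and
    Cauchy-Schwarz bounds it. The modulus around [sqrtC (k z z)] spares a positivity argument for
    [k]. *)
Lemma ev_continuous z : continuous (fun f => ev f z).
Proof.
apply: (@lipschitz_linear_continuous _ _ _ _ `|sqrtC (k z z)|).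
  exact: ev_linear.
move=> f; have [->|fz0] := eqVneq (ev f z) 0; first by rewrite normr0 mulr_ge0.
have kE : `|kernel_fun z (ev f z)| = `|sqrtC (k z z)| * `|ev f z|.
  apply: (@pexpIrn _ 2) => //; rewrite ?nnegrE ?mulr_ge0// exprMn -normrX sqrtCK.
  rewrite -[LHS]ger0_norm ?exprn_ge0// -hdot_norm hdot_kernel_fun ev_kernel_fun.
  by rewrite hdotZl hdot_norm normrM [X in _ * X]ger0_norm ?exprn_ge0.
rewrite -(@ler_pM2r _ `|ev f z|) ?normr_gt0// mulrAC -kE.
rewrite -expr2 -[leLHS]ger0_norm ?exprn_ge0// -hdot_norm -hdot_kernel_fun mulrC.
exact: norm_hdot_le.
Qed.

End Rkhs.

(** * Multiplication operators *)

Section MulOperator.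
Variables (R : realType) (X : Type) (k1 k2 : X -> X -> R[i]) (E1 E2 : hilbertType R).
Variables (H1 : rkhs k1 E1) (H2 : rkhs k2 E2) (phi : X -> E1 -> E2).

Lemma is_product_mulop (f : H1) (g : H2) :
  is_product phi f g -> mulop H1 H2 phi f = g.
Proof.
move=> fg; have mf : is_product phi f (mulop H1 H2 phi f).
  by apply: (@xgetPex _ 0 [set g : H2 | is_product phi f g]); exists g.
by apply: ev_inj => z; rewrite mf fg.
Qed.

Hypothesis phi_multiplier : multiplier H1 H2 phi.

Lemma ev_mulop (f : H1) z : ev (mulop H1 H2 phi f) z = phi z (ev f z).
Proof. by have [g fg] := phi_multiplier f; rewrite (is_product_mulop fg). Qed.

Lemma mulop_linear : (forall z, linear (phi z)) -> linear (mulop H1 H2 phi).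
Proof.
move=> phil a f g; apply: is_product_mulop => z.
by rewrite !evD !evZ !ev_mulop phil.
Qed.

End MulOperator.

(** Lagrange's identity: twice the difference of the two sides is a sum of squares. *)
Lemma sum_cauchy_schwarz (R : numDomainType) n (a t : 'I_n -> R) :
  (forall i, a i \is Num.real) -> (forall i, t i \is Num.real) ->
  (\sum_i a i * t i) ^+ 2 <= (\sum_i a i ^+ 2) * (\sum_i t i ^+ 2).
Proof.
move=> ar tr; rewrite -subr_ge0 -(@pmulr_rge0 _ 2)//.
have -> : 2 * ((\sum_i a i ^+ 2) * (\sum_i t i ^+ 2) - (\sum_i a i * t i) ^+ 2) =
    \sum_i \sum_j (a i * t j - a j * t i) ^+ 2.
  under [RHS]eq_bigr do under eq_bigr do rewrite sqrrB !exprMn mulr2n.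
  rewrite mulrBr !mulrDl !mul1r {2}[_ * \sum_i t i ^+ 2]mulrC expr2 !big_distrlr /=.
  rewrite -!big_split -sumrB /=; apply: eq_bigr => i _.
  rewrite -!big_split -sumrB /=; apply: eq_bigr => j _.
  ring.
apply: sumr_ge0 => i _; apply: sumr_ge0 => j _.
by rewrite real_exprn_even_ge0// rpredB ?rpredM.
Qed.

(** * The Drury-Arveson space: coordinate multipliers and constants *)

Section DruryArveson.
Variables (R : realType) (n : nat) (E : hilbertType R).
Variable H : rkhs (drury_arveson_kernel R n) E.
Implicit Types (f g : H) (z w : unit_ball R n) (x y : E).

Let ip z w := \sum_(i < n) val z ord0 i * Num.conj (val w ord0 i).

(** After doubling, [2 |z_i| |w_i| <= |z_i|^2 + |w_i|^2] reduces it to the two norm conditions of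
    the ball. *)
Lemma ip_lt1 z w : `|ip z w| < 1.
Proof.
rewrite -(@ltr_pM2l _ 2)// mulr1.
apply: (@le_lt_trans _ _ (\sum_(i < n) (`|val z ord0 i| ^+ 2 + `|val w ord0 i| ^+ 2))).
  apply: (@le_trans _ _ (2 * \sum_(i < n) `|val z ord0 i * Num.conj (val w ord0 i)|)).
    by rewrite ler_pM2l// ler_norm_sum.
  rewrite mulr_sumr; apply: ler_sum => i _; rewrite normrM norm_conjC -subr_ge0.
  set s := `|_|; set t := `|_|.
  have -> : s ^+ 2 + t ^+ 2 - 2 * (s * t) = (s - t) ^+ 2 by ring.
  by rewrite real_exprn_even_ge0// rpredB ?normr_real.
by rewrite big_split /= ltrD ?(valP z) ?(valP w).
Qed.

(** This is [1 / (1 - t) = 1 + t / (1 - t)], the only fact about the kernel behind the norm identity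
    and [kernel_fun_rec]. *)
Lemma drury_arveson_rec z w :
  drury_arveson_kernel R n z w = 1 + ip z w * drury_arveson_kernel R n z w.
Proof.
have n0 : 1 - ip z w != 0.
  rewrite subr_eq0; apply/eqP => e; have := ip_lt1 z w.
  by rewrite -e normr1 ltxx.
rewrite /drury_arveson_kernel -/(ip z w); apply: (mulIf n0).
by rewrite mulrDl -mulrA mulVf// mulr1 mul1r subrK.
Qed.

Lemma origin_subproof : \sum_(i < n) `|(0 : 'rV[R[i]]_n) ord0 i| ^+ 2 < 1.
Proof.
by rewrite big1 ?ltr01// => i _; rewrite mxE normr0 expr0n.
Qed.

Definition origin : unit_ball R n := exist _ 0 origin_subproof.

Lemma drury_arveson_origin z : drury_arveson_kernel R n z origin = 1.
Proof.
by rewrite /drury_arveson_kernel big1 ?subr0 ?invr1// => i _; rewrite mxE rmorph0 mulr0.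
Qed.

Let hs (s : seq (unit_ball R n * E)) : H := \sum_(p <- s) kernel_fun H p.1 p.2.
Let hsi i (s : seq (unit_ball R n * E)) : H :=
  \sum_(p <- s) Num.conj (val p.1 ord0 i) *: kernel_fun H p.1 p.2.

(* The dual form of [sum_i M_i M_i^* = I - (projection onto the constants)], on
   the dense subspace of combinations of kernel functions. *)
Let hs_normE s :
  `|hs s| ^+ 2 = `|\sum_(p <- s) p.2| ^+ 2 + \sum_(i < n) `|hsi i s| ^+ 2.
Proof.
rewrite -!hdot_norm !hdot_suml; under [X in _ + X]eq_bigr do rewrite -hdot_norm hdot_suml.
rewrite exchange_big -big_split /=; apply: eq_bigr => p _.
rewrite !hdot_sumr; under [X in _ + X]eq_bigr do rewrite hdot_sumr.
rewrite exchange_big -big_split /=; apply: eq_bigr => q _.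
under eq_bigr do rewrite hdotZl hdotZr conjCK mulrA.
rewrite -mulr_suml hdot_kernel_fun ev_kernel_fun hdotZl {1}drury_arveson_rec.
rewrite mulrDl mul1r -mulrA /ip; congr (_ + _ * _).
by apply: eq_bigr => i _; rewrite mulrC.
Qed.

(** The product is built by duality. The adjoint of the multiplication must scale each kernel
    function by the conjugate of [sum_i a_i w_i]; on combinations of kernel functions this map [b]
    is bounded by [hs_normE] and Cauchy-Schwarz, and Riesz applied to [<b s, f>] yields [u]. *)
Lemma linear_form_product (a : 'I_n -> R[i]) f : exists u : H,
  (forall z, ev u z = (\sum_(i < n) a i * val z ord0 i) *: ev f z) /\
  `|u| <= sqrtC (\sum_(i < n) `|a i| ^+ 2) * `|f|.
Proof.
pose r := sqrtC (\sum_(i < n) `|a i| ^+ 2).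
have r0 : 0 <= r by rewrite sqrtC_ge0 sumr_ge0// => i _; rewrite exprn_ge0.
pose b s := \sum_(i < n) Num.conj (a i) *: hsi i s.
have b_le s : `|b s| <= r * `|hs s|.
  rewrite -(@ler_pXn2r _ 2) ?nnegrE ?mulr_ge0// exprMn sqrtCK hs_normE.
  apply: (@le_trans _ _ ((\sum_(i < n) `|a i| * `|hsi i s|) ^+ 2)).
    rewrite ler_pXn2r ?nnegrE ?sumr_ge0// => [|i _]; last exact: mulr_ge0.
    apply: le_trans (ler_norm_sum _ _ _) _; apply: ler_sum => i _.
    by rewrite normrZ norm_conjC.
  apply: le_trans (sum_cauchy_schwarz _ _) _ => [i|i|]; rewrite ?normr_real//.
  rewrite ler_wpM2l ?lerDr ?exprn_ge0// sumr_ge0// => i _; exact: exprn_ge0.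
pose G h c := exists s, h = hs s /\ c = hdot (b s) f.
have [||||u [uP _ ur]] := @riesz_graph _ _ G (r * `|f|).
- by rewrite mulr_ge0.
- exists [::]; rewrite /hs big_nil; split=> //.
  rewrite /b big1 ?hdot0l// => i _; by rewrite /hsi big_nil scaler0.
- move=> c _ _ _ _ [s [-> ->]] [t [-> ->]].
  (* The lists carry no coefficients, so the scalar is absorbed into the vectors of [E]. *)
  exists ([seq (p.1, c *: p.2) | p <- s] ++ t); split.
    rewrite /hs big_cat big_map /= scaler_sumr; congr (_ + _).
    by apply: eq_bigr => p _; rewrite kernel_funZ.
  rewrite -hdotZl -hdotDl; congr hdot.
  rewrite /b scaler_sumr -big_split /=; apply: eq_bigr => i _.
  rewrite /hsi big_cat big_map /= scalerDr; congr (_ + _).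
  rewrite !scaler_sumr; apply: eq_bigr => p _.
  by rewrite kernel_funZ !scalerA; congr (_ *: _); ring.
- move=> h c [s [-> ->]]; apply: le_trans (norm_hdot_le _ _) _.
  by rewrite mulrAC ler_wpM2r.
exists u; split=> // z; apply/eqP; rewrite -subr_eq0; apply/eqP/hdot_eq0.
(* The two values at [z] are compared by testing [u] on the kernel function at [z] in the direction
   of their difference [v]. *)
set v := _ - _; rewrite {1}/v hdotBl -hdot_kernel_fun hdot_conj.
rewrite (uP _ (hdot (b [:: (z, v)]) f)); last first.
  by exists [:: (z, v)]; rewrite /hs big_seq1.
rewrite -hdot_conj /b hdot_sumr hdotZl mulr_suml -sumrB big1// => i _.
by rewrite /hsi big_seq1 !hdotZr !conjCK hdot_kernel_fun; ring.
Qed.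

Lemma coordinate_multiplier i : multiplier H H (@coordinate R n E i).
Proof.
move=> f; have [u [uE _]] := linear_form_product (fun j => (j == i)%:R) f.
exists u => z; rewrite uE (bigD1 i)//= eqxx mul1r big1 ?addr0// => j ji.
by rewrite (negPf ji) mul0r.
Qed.

Lemma ev_Mz i f z : ev (Mz H i f) z = val z ord0 i *: ev f z.
Proof. exact: (ev_mulop (@coordinate_multiplier i)). Qed.

Lemma const_funE x : const_fun H x = kernel_fun H origin x.
Proof.
have kE z : ev (kernel_fun H origin x) z = x.
  by rewrite ev_kernel_fun drury_arveson_origin scale1r.
have := @xgetPex _ 0 [set f : H | forall z, ev f z = x] (ex_intro _ _ kE).
by move=> cE; apply: ev_inj => z; rewrite kE; exact: cE.
Qed.

Lemma ev_const_fun x z : ev (const_fun H x) z = x.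
Proof. by rewrite const_funE ev_kernel_fun drury_arveson_origin scale1r. Qed.

Lemma hdot_const_fun f x : hdot f (const_fun H x) = hdot (ev f origin) x.
Proof. by rewrite const_funE hdot_kernel_fun. Qed.

Lemma norm_const_fun x : `|const_fun H x| = `|x|.
Proof.
apply: (@pexpIrn _ 2) => //; rewrite ?nnegrE//.
by rewrite -!hdot_norm hdot_const_fun ev_const_fun.
Qed.

Lemma kernel_fun_rec w x : kernel_fun H w x =
  const_fun H x + \sum_(i < n) Num.conj (val w ord0 i) *: Mz H i (kernel_fun H w x).
Proof.
apply: ev_inj => z; rewrite evD ev_const_fun ev_sum ev_kernel_fun {1}drury_arveson_rec.
rewrite scalerDl scale1r /ip mulr_suml scaler_suml; congr (_ + _).
apply: eq_bigr => i _; rewrite evZ ev_Mz ev_kernel_fun !scalerA; congr (_ *: _).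
ring.
Qed.

(** By [kernel_fun_rec], [f] has the same inner product with the kernel function at [w] as with the
    constant, so its value at [w] is its value at the origin. *)
Lemma orthogonal_Mz_const f :
  (forall i g, hdot f (Mz H i g) = 0) -> f = const_fun H (ev f origin).
Proof.
move=> fM; apply: ev_inj => w; rewrite ev_const_fun.
apply/eqP; rewrite -subr_eq0; apply/eqP/hdot_eq0; set v := _ - _.
rewrite {1}/v hdotBl -hdot_kernel_fun -hdot_const_fun {1}kernel_fun_rec.
rewrite hdotDr hdot_sumr big1 ?addr0 ?subrr// => i _.
by rewrite hdotZr fM mulr0.
Qed.

Lemma hdot_Mz_const i g x : hdot (Mz H i g) (const_fun H x) = 0.
Proof. by rewrite hdot_const_fun ev_Mz mxE scale0r hdot0l. Qed.

End DruryArveson.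

(** * Spans, closures, orthogonal complements and adjoints *)

Section Subspaces.
Variables (R : realType) (H : hilbertType R).
Implicit Types (A B L : set H).

Lemma linear_span_min A L : is_subspace L -> A `<=` L -> linear_span A `<=` L.
Proof.
move=> [L0 LL] AL _ [m [c [v [Av ->]]]].
elim/big_ind: _ => // [x y Lx Ly|j _]; first by rewrite -[x]scale1r; exact: LL.
by rewrite -[_ *: _]addr0; apply: LL => //; exact/AL/Av.
Qed.

Lemma sub_linear_span A : A `<=` linear_span A.
Proof.
move=> x Ax; exists 1%N, (fun=> 1), (fun=> x); split=> //.
by rewrite big_ord1 scale1r.
Qed.

Lemma linear_span_subspace A : is_subspace (linear_span A).
Proof.
split=> [|a _ _ [m [c [v [Av ->]]]] [p [d [w [Aw ->]]]]].
  by exists 0%N, (fun=> 0), (fun=> 0); split=> [[]|] //; rewrite big_ord0.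
exists (m + p)%N,
  (fun j : 'I_(m + p) =>
     match fintype.split j with inl i => a * c i | inr i => d i end),
  (fun j : 'I_(m + p) =>
     match fintype.split j with inl i => v i | inr i => w i end); split.
  by move=> j; case: (fintype.split j).
rewrite big_split_ord scaler_sumr /=; congr (_ + _); apply: eq_bigr => j _.
  by rewrite (unsplitK (inl j)) scalerA.
by rewrite (unsplitK (inr j)).
Qed.

Lemma closure_min_closed A B : closed B -> A `<=` B -> closure A `<=` B.
Proof. by move=> cB AB; rewrite [B](proj1 (closure_id _) cB); exact: closure_subset. Qed.

Lemma closure_closure A : closure (closure A) = closure A.
Proof. exact: (esym (proj1 (closure_id _) (@closed_closure _ A))). Qed.

Lemma orthogonal_set_closure A x : orthogonal_set A x -> orthogonal_set (closure A) x.
Proof.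
move=> Ax; apply: closure_min_closed (Ax : A `<=` [set y | hdot x y = 0]).
exact: (closed_zero_set (V := R[i]) (@hdotr_continuous R H x)).
Qed.

Lemma orthogonal_set_subspace A : is_subspace (orthogonal_set A).
Proof.
split=> [y _|a x y Ax Ay z Az]; first exact: hdot0l.
by rewrite hdotDl hdotZl Ax// Ay// mulr0 addr0.
Qed.

Lemma image_closure (V : hilbertType R) (f : H -> V) A : continuous f ->
  f @` closure A `<=` closure (f @` A).
Proof.
move=> cf _ [x Ax <-] B /cf fB; have [y [Ay By]] := Ax _ fB.
by exists (f y); split=> //; exists y.
Qed.

(** The norm of the subspace is the restricted one, so an ambient ball around [x] meets the subspace
    in a ball. *)
Lemma closure_cs_val (S : closedSubspace H) (D : set (subspaceType S)) x :
  closure (@cs_val R H S @` D) (cs_val x) -> closure D x.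
Proof.
move=> Dx B /nbhs_ballP[e /= e0 eB].
have [_ [[d Dd <-] xd]] := Dx _ (nbhsx_ballx (cs_val x) e e0).
by exists d; split=> //; apply: eB; move: xd; rewrite -!ball_normE.
Qed.

Lemma adjointE (V : hilbertType R) (T : H -> V) y x :
  (forall h, hdot (T h) y = hdot h x) -> adjoint T y = x.
Proof.
move=> Tx; have := @xgetPex _ 0 [set x : H | forall h, hdot (T h) y = hdot h x]
  (ex_intro _ x Tx).
rewrite -/(adjoint T y) /= => Ty.
apply/eqP; rewrite -subr_eq0; apply/eqP/hdot_eq0.
by rewrite hdotBr -Ty -Tx subrr.
Qed.

End Subspaces.

(** * Powers of operator tuples *)

Section TuplePow.
Variables (R : realType) (n : nat).

(** A relation covers in one induction the intertwining by an operator, the passage to a restriction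
    and the invariance of a set. *)
Lemma tuple_pow_rel (H1 H2 : hilbertType R) (Rel : H1 -> H2 -> Prop)
    (T1 : 'I_n -> H1 -> H1) (T2 : 'I_n -> H2 -> H2) (k : 'I_n -> nat) x y :
  (forall i x y, Rel x y -> Rel (T1 i x) (T2 i y)) -> Rel x y ->
  Rel (tuple_pow T1 k x) (tuple_pow T2 k y).
Proof.
move=> RT; rewrite /tuple_pow.
move: x y; apply: (big_ind2 (fun f g => forall x y, Rel x y -> Rel (f x) (g y))) => //.
  by move=> f1 g1 f2 g2 fg1 fg2 x y xy; apply: fg1; exact: fg2.
by move=> i _ x y xy; elim: (k i) => //= j; exact: RT.
Qed.

Lemma ev_tuple_pow_Mz (E : hilbertType R) (H : rkhs (drury_arveson_kernel R n) E)
    (k : 'I_n -> nat) (f : H) z :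
  ev (tuple_pow (Mz H) k f) z = (\prod_(i < n) val z ord0 i ^+ k i) *: ev f z.
Proof.
rewrite /tuple_pow; move: f.
apply: (big_ind2 (fun (T : H -> H) (c : R[i]) => forall f, ev (T f) z = c *: ev f z)).
- by move=> f; rewrite scale1r.
- by move=> T1 c1 T2 c2 T1E T2E f; rewrite /= T1E T2E scalerA.
- move=> i _ f; elim: (k i) => [|j IHj]; first by rewrite scale1r.
  by rewrite iterS ev_Mz IHj scalerA exprS.
Qed.

End TuplePow.

(** * Partial isometries with closed kernel *)

Section PartialIsometry.
Variables (R : realType) (U V : hilbertType R) (T : U -> V).
Hypothesis T_linear : linear T.
Hypothesis T_ker_closed : closed [set x | T x = 0].
Hypothesis T_isometry : partial_isometry T.

Let kerT := [set x | T x = 0].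

Let T0 : T 0 = 0.
Proof.
by apply: (addrI (1 *: T 0)); rewrite -T_linear scaler0 !addr0 scale1r.
Qed.

Lemma ker_decomposition x : exists u v, [/\ x = u + v, T u = 0 & orthogonal_set kerT v].
Proof.
have kerS : is_subspace kerT.
  by split=> [|a f g Tf Tg]; rewrite /kerT/= ?T0// T_linear Tf Tg scaler0 addr0.
have [u [v [-> Cu kv]]] := orthogonal_decomposition x kerS.
by exists u, v; split=> //; exact: (closure_min_closed T_ker_closed _ Cu).
Qed.

Let TD x y : T (x + y) = T x + T y.
Proof. by rewrite -[x]scale1r T_linear !scale1r. Qed.

Lemma partial_isometry_hdot x y :
  orthogonal_set kerT x -> hdot (T x) (T y) = hdot x y.
Proof.
move=> kx; have [u [v [-> Tu kv]]] := ker_decomposition y.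
rewrite TD Tu add0r hdotDr (kx _ Tu) add0r.
apply/eqP; rewrite -subr_eq0 -normr_eq0 -sqrf_eq0; apply/eqP.
set s := _ - _.
(* Equality of norms at [a *: x + v] only gives that [a * s] has real part zero; [a = Num.conj s]
   turns this into [|s|^2 = 0]. *)
have E : Num.conj s * s + Num.conj (Num.conj s * s) = 0.
  have kvx : orthogonal_set kerT (Num.conj s *: x + v).
    exact: (orthogonal_set_subspace _).2.
  have := congr1 (fun t => t ^+ 2) (T_isometry kvx).
  have cancel (A B C D : R[i]) : A + B + C = A + D + C -> B = D by move=> /addIr/addrI.
  rewrite T_linear addrC [_ *: _ + v]addrC !norm2DZ !T_isometry// => /cancel e.
  have sM c : c * s = c * hdot (T x) (T v) - c * hdot x v by rewrite -mulrBr.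
  move: (Num.conj s) e => a e.
  by rewrite sM rmorphB /= addrACA -opprD e subrr.
move: E; rewrite [Num.conj s * s]mulrC -normCK.
have -> : Num.conj (`|s| ^+ 2) = `|s| ^+ 2 by apply/CrealP; rewrite rpredX ?normr_real.
by move/eqP; rewrite -mulr2n mulrn_eq0 => /eqP.
Qed.

Lemma partial_isometry_contractive x : `|T x| <= `|x|.
Proof.
have [u [v [-> Tu kv]]] := ker_decomposition x.
rewrite TD Tu add0r T_isometry// -(@ler_pXn2r _ 2) ?nnegrE//.
rewrite -!hdot_norm hdotDl !hdotDr (kv _ Tu) (hdot_sym0 (kv _ Tu)) addr0 add0r.
by rewrite lerDr hdot_norm exprn_ge0.
Qed.

Lemma partial_isometry_continuous : continuous T.
Proof.
apply: (@lipschitz_linear_continuous _ _ _ _ 1) => // x.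
by rewrite mul1r partial_isometry_contractive.
Qed.

(** The composite of [T] with its adjoint is the projection onto the orthogonal complement of the
    kernel. *)
Lemma adjoint_fixed_orthogonal x :
  adjoint T (T x) = x <-> orthogonal_set kerT x.
Proof.
split=> [Tx|kx]; last first.
  by apply: adjointE => h; rewrite hdot_conj partial_isometry_hdot// -hdot_conj.
(* Without a representing vector [adjoint] would return its default [0], and the hypothesis would
   make [x] zero. *)
have [[x' x'P]|nx] := pselect (exists x', forall h, hdot (T h) (T x) = hdot h x').
  move=> y Ty; apply: hdot_sym0.
  by rewrite -Tx (adjointE x'P) -x'P Ty hdot0l.
rewrite -Tx /adjoint xgetPN; last by move=> x' x'P; apply: nx; exists x'.
by move=> y _; exact: hdot0l.
Qed.

End PartialIsometry.

(** * Density of monomials in the functions with values in a closed subspace *)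

Section DruryArvesonSubspaces.
Variables (R : realType) (n : nat) (E : hilbertType R).
Variable H : rkhs (drury_arveson_kernel R n) E.

Lemma Mz_linear i : linear (Mz H i).
Proof.
move=> a f g; apply: ev_inj => z.
by rewrite evD evZ !ev_Mz evD evZ scalerDr !scalerA mulrC.
Qed.

Lemma const_fun_linear : linear (const_fun H).
Proof. by move=> a x y; apply: ev_inj => z; rewrite evD evZ !ev_const_fun. Qed.

Lemma const_fun_continuous : continuous (const_fun H).
Proof.
apply: (@lipschitz_linear_continuous _ _ _ _ 1); first exact: const_fun_linear.
by move=> x; rewrite mul1r norm_const_fun.
Qed.

Lemma Mz_tuple_pow i k (f : H) :
  Mz H i (tuple_pow (Mz H) k f) = tuple_pow (Mz H) (fun j => (j == i) + k j)%N f.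
Proof.
apply: ev_inj => z; rewrite ev_Mz !ev_tuple_pow_Mz scalerA; congr (_ *: _).
under [RHS]eq_bigr do rewrite exprD.
rewrite big_split /=; congr (_ * _).
rewrite (bigD1 i)//= eqxx expr1 big1 ?mulr1// => j ji.
by rewrite (negPf ji).
Qed.

Definition monomials (F : set E) : set H :=
  \bigcup_(k in [set: 'I_n -> nat]) (tuple_pow (Mz H) k @` (const_fun H @` F)).

Lemma monomials_Mz (F : set E) i f :
  linear_span (monomials F) f -> linear_span (monomials F) (Mz H i f).
Proof.
have [S0 SL] := linear_span_subspace (monomials F).
have Mz0 : Mz H i 0 = 0 by apply: ev_inj => z; rewrite ev_Mz ev0 scaler0.
move: f; apply: linear_span_min.
  by split=> [|a f g]; rewrite /= ?Mz0// Mz_linear; exact: SL.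
move=> _ [k _ [f fF <-]]; apply: sub_linear_span.
by rewrite /= Mz_tuple_pow; eexists; last by exists f; first exact: fF.
Qed.

Lemma kernel_fun_closure_monomials (F : set E) w x : F x ->
  closure (linear_span (monomials F)) (kernel_fun H w x).
Proof.
move=> Fx; set L := linear_span _.
have LS : is_subspace L by exact: linear_span_subspace.
(* [A] multiplies by [<z, w>], and [r] is the norm of [w], so [linear_form_product] makes [A] a
   strict contraction. *)
pose A f := \sum_(i < n) Num.conj (val w ord0 i) *: Mz H i f.
pose r := sqrtC (\sum_(i < n) `|Num.conj (val w ord0 i)| ^+ 2).
have A_le f : `|A f| <= r * `|f|.
  have [u [uE ur]] := linear_form_product (fun i => Num.conj (val w ord0 i)) f.
  rewrite (_ : A f = u)//; apply: ev_inj => z; rewrite ev_sum uE scaler_suml.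
  by apply: eq_bigr => i _; rewrite evZ ev_Mz scalerA.
have A_linear : linear A.
  move=> a f g; rewrite scaler_sumr -big_split /=; apply: eq_bigr => i _.
  by rewrite Mz_linear scalerDr !scalerA mulrC.
have A_continuous : continuous A by exact: lipschitz_linear_continuous A_le.
have r1 : r < 1.
  have sqrtC_lt1 (t : R[i]) : 0 <= t -> t < 1 -> sqrtC t < 1.
    by move=> t0 t1; rewrite -sqrtC1 ltr_sqrtC ?qualifE/= ?ler01.
  apply: sqrtC_lt1; first by apply: sumr_ge0 => i _; exact: exprn_ge0.
  by under eq_bigr do rewrite norm_conjC; exact: (valP w).
have AL f : closure L f -> closure L (A f).
  move=> Lf; suff AsL : A @` L `<=` L.
    by apply: (closure_subset AsL); apply: (image_closure A_continuous); exists f.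
  move=> _ [g Lg <-]; rewrite /A; elim/big_ind: _ => [|a b La Lb|i _]; first exact: LS.1.
    by rewrite -[a]scale1r; exact: LS.2.
  by rewrite -[_ *: _]addr0; apply: LS.2 LS.1; exact: monomials_Mz.
have [p [q [kE Lp Lq]]] := orthogonal_decomposition (kernel_fun H w x) LS.
have q0 f : closure L f -> hdot f q = 0.
  by move=> Lf; apply: hdot_sym0; exact: (orthogonal_set_closure Lq).
have Lx : closure L (const_fun H x).
  apply/subset_closure/sub_linear_span; exists (fun=> 0%N) => //.
  exists (const_fun H x); first by exists x.
  apply: ev_inj => z; rewrite ev_tuple_pow_Mz big1 ?scale1r//.
(* Substituting [kernel_fun_rec] for the left [q] leaves only [A q]: the constant, [p] and [A p] all
   lie in the closure of [L]. *)
have : hdot q q = hdot (A q) q.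
  have {1}-> : q = const_fun H x + A (kernel_fun H w x) - p.
    by rewrite -kernel_fun_rec kE addrAC subrr add0r.
  have -> : A (kernel_fun H w x) = A p + A q.
    by rewrite kE -[p]scale1r A_linear !scale1r.
  by rewrite hdotBl !hdotDl (q0 _ Lx) (q0 _ Lp) (q0 _ (AL _ Lp)) !add0r subr0.
rewrite hdot_norm => qq; suff q_0 : q = 0 by rewrite kE q_0 addr0.
apply/eqP/negPn/negP => qn0.
have : `|q| ^+ 2 <= r * `|q| ^+ 2.
  rewrite -[leLHS]ger0_norm ?exprn_ge0// {1}qq; apply: le_trans (norm_hdot_le _ _) _.
  by rewrite expr2 mulrA ler_wpM2r.
have qr : r * `|q| ^+ 2 < `|q| ^+ 2 by rewrite gtr_pMl ?exprn_gt0 ?normr_gt0.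
by move=> /le_lt_trans /(_ qr); rewrite ltxx.
Qed.

(** The projection of [f] is a limit of [F]-valued functions, hence [F]-valued, and so is the
    remainder [v]. Then [v] is orthogonal to the kernel function at [z] in the direction [ev v z],
    which forces [ev v z = 0]. *)
Lemma closure_monomials (F : closedSubspace E) (f : H) :
  (forall z, cs_set F (ev f z)) -> closure (linear_span (monomials (cs_set F))) f.
Proof.
move=> fF; set L := linear_span _; have [F0 FL] := cs_subspace F.
have [u [v [fE Lu Lv]]] :=
  orthogonal_decomposition f (linear_span_subspace _ : is_subspace L).
suff v0 : v = 0 by rewrite fE v0 addr0.
have uF z : cs_set F (ev u z).
  have cF : closed [set g : H | cs_set F (ev g z)].
    apply: closed_preimage_hilbert; [exact: ev_continuous|exact: cs_closed].
  apply: (closure_min_closed cF _ Lu); apply: linear_span_min => /=.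
    by split=> [|a g h]; rewrite /= ?ev0// evD evZ; exact: FL.
  move=> _ [k _ [_ [x Fx <-] <-]] /=; rewrite ev_tuple_pow_Mz ev_const_fun.
  by rewrite -[_ *: _]addr0; exact: FL.
apply: ev_inj => z; rewrite ev0; apply: hdot_eq0.
rewrite -hdot_kernel_fun; apply: (orthogonal_set_closure Lv).
apply: kernel_fun_closure_monomials.
have -> : ev v z = -1 *: ev u z + ev f z by rewrite fE evD scaleN1r addKr.
exact: FL.
Qed.

End DruryArvesonSubspaces.

(** * The multiplication operator and its inner part *)

Section PartiallyIsometricMultiplier.
Variables (R : realType) (n : nat) (K : unit_ball R n -> unit_ball R n -> R[i]).
Variables (Es : hilbertType R) (HKE : rkhs K Es) (E : hilbertType R).
Variables (H2E : rkhs (drury_arveson_kernel R n) E).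
Variable Theta : unit_ball R n -> boundedOp E Es.
Hypothesis Theta_multiplier : multiplier H2E HKE Theta.
Hypothesis Theta_partial_isometry : partial_isometry (mulop H2E HKE Theta).

Let M := mulop H2E HKE Theta.

Let ev_M f z : ev (M f) z = Theta z (ev f z).
Proof. exact: (ev_mulop Theta_multiplier). Qed.

Let M_linear : linear M.
Proof. by apply: (mulop_linear Theta_multiplier) => z; exact: linearP. Qed.

(** Point evaluations and each [Theta z] are continuous, so the kernel is closed before [M] is known
    to be continuous; this feeds the theory of partial isometries, which then gives continuity. *)
Let M_ker_closed : closed [set f | M f = 0].
Proof.
have -> : [set f | M f = 0] = \bigcap_(z in setT) [set f | Theta z (ev f z) = 0].
  apply/seteqP; split=> f /= Mf.
    by move=> z _ /=; rewrite -ev_M Mf ev0.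
  by apply: ev_inj => z; rewrite ev_M ev0; exact: Mf.
apply: closed_bigI => z _; apply: closed_zero_set => f.
by apply: continuous_comp; [exact: ev_continuous|exact: bop_continuous].
Qed.

Let M_continuous : continuous M.
Proof. exact: partial_isometry_continuous. Qed.

Let M0 : M 0 = 0.
Proof. by apply: ev_inj => z; rewrite ev_M !ev0 linear0. Qed.

Let MD f g : M (f + g) = M f + M g.
Proof. by rewrite -[f]scale1r M_linear !scale1r. Qed.

(* The products defining [Mz HKE] exist on the range of [M] because they exist in
   the Drury-Arveson space; elsewhere [Mz HKE] may take its junk value [0]. *)
Lemma Mz_mulop i f : Mz HKE i (M f) = M (Mz H2E i f).
Proof.
by apply: is_product_mulop => z; rewrite !ev_M ev_Mz linearZ.
Qed.

Lemma tuple_pow_mulop k f :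
  tuple_pow (Mz HKE) k (M f) = M (tuple_pow (Mz H2E) k f).
Proof.
apply: (tuple_pow_rel (Rel := fun g f => g = M f)) => // i _ g ->.
exact: Mz_mulop.
Qed.

Let kerM := [set f | M f = 0].

Lemma fixed_set_subspace :
  is_subspace [set eta | orthogonal_set kerM (const_fun H2E eta)].
Proof.
have [O0 OL] := orthogonal_set_subspace kerM.
split=> [|a x y]; rewrite /= ?const_fun_linear; last exact: OL.
suff -> : const_fun H2E 0 = 0 by [].
by apply: ev_inj => z; rewrite ev_const_fun ev0.
Qed.

Lemma fixed_set_closed :
  closed [set eta | orthogonal_set kerM (const_fun H2E eta)].
Proof.
apply: closed_preimage_hilbert; first exact: const_fun_continuous.
exact: closed_orthogonal_set.
Qed.

(** Orthogonality to the kernel makes closedness and linearity immediate; [fixed_spaceE] recovers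
    the description by the adjoint. *)
Definition fixed_space : closedSubspace E :=
  ClosedSubspace fixed_set_subspace fixed_set_closed.

Local Notation F := fixed_space.
Local Notation Theta0 := (fun z => bop_restr (Theta z) F).

Lemma fixed_spaceE :
  cs_set F = [set eta | adjoint M (M (const_fun H2E eta)) = const_fun H2E eta].
Proof.
apply/seteqP; split=> eta /=.
  exact: (adjoint_fixed_orthogonal M_linear M_ker_closed Theta_partial_isometry _).2.
exact: (adjoint_fixed_orthogonal M_linear M_ker_closed Theta_partial_isometry _).1.
Qed.

Lemma range_constE :
  range_const HKE Theta0 = [set M (const_fun H2E eta) | eta in cs_set F].
Proof.
apply/seteqP; split=> [g [x gE]|_ [eta Feta <-]].
  exists (cs_val x); first exact: cs_valP.
  by apply: ev_inj => z; rewrite gE ev_M ev_const_fun.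
by exists (SubspaceElt (asboolT Feta)) => z; rewrite ev_M ev_const_fun.
Qed.

Let hdot_M_const eta f : cs_set F eta ->
  hdot (M (const_fun H2E eta)) (M f) = hdot (const_fun H2E eta) f.
Proof. exact: partial_isometry_hdot. Qed.

Lemma norm_mulop_const eta : cs_set F eta -> `|M (const_fun H2E eta)| = `|eta|.
Proof. by move=> Feta; rewrite Theta_partial_isometry// norm_const_fun. Qed.

(** [M] preserves inner products against constants from [F], and a nontrivial monomial vanishes at
    the origin, hence is orthogonal to the constants. *)
Lemma range_const_orthogonal k : (exists i, k i != 0%N) ->
  orthogonal_sets (range_const HKE Theta0)
    (tuple_pow (Mz HKE) k @` range_const HKE Theta0).
Proof.
move=> [i ki]; rewrite range_constE => _ _ [x Fx <-] [_ [y Fy <-] <-].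
rewrite tuple_pow_mulop hdot_M_const//; apply: hdot_sym0.
rewrite hdot_const_fun ev_tuple_pow_Mz (bigD1 i)//= mxE expr0n (negPf ki).
by rewrite mul0r scale0r hdot0l.
Qed.

Lemma K_inner_fixed_space : K_inner HKE Theta0.
Proof.
split=> [x|k k0]; last exact: range_const_orthogonal.
exists (M (const_fun H2E (cs_val x))); split=> [z|].
  by rewrite ev_M ev_const_fun.
by rewrite norm_mulop_const//; exact: cs_valP.
Qed.

(** * The wandering subspace of the range *)

Section Range.
Variable S : closedSubspace HKE.
Hypothesis S_invariant : invariant_under (Mz HKE) (cs_set S).
Hypothesis S_range : cs_set S = range M.

Let W := ominus (cs_set S) (tuple_range_sum (Mz HKE) (cs_set S)).
Let W_S := @cs_val R HKE S @^-1` W.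
Let Mz_S := tuple_restrict S_invariant.

Lemma wandering_subspaceE : W = range_const HKE Theta0.
Proof.
rewrite range_constE; apply/seteqP; split=> [y [Sy yT]|_ [eta Feta <-]].
  move: Sy yT; rewrite S_range => -[g _ <-].
  (* Only the component of [g] orthogonal to the kernel matters, and there [M] preserves inner
     products. *)
  have [u [f [-> Mu kf]]] := ker_decomposition M_linear M_ker_closed g.
  rewrite MD Mu add0r => fT.
  have fE : f = const_fun H2E (ev f (origin R n)).
    apply: orthogonal_Mz_const => i h.
    rewrite -(partial_isometry_hdot M_linear M_ker_closed Theta_partial_isometry)//.
    (* A family supported at [i] isolates the single product [z_i M h] in the range sum. *)
    apply: fT; exists (fun j => if j == i then M h else 0); split.
      move=> j; case: eqP => _; first by exists h.
      by exists 0 => //; exact: M0.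
    rewrite (bigD1 i)//= eqxx Mz_mulop big1 ?addr0// => j /negPf ->.
    (* Writing [0] as [M 0] brings the product into the range of [M], where [Mz HKE] is known. *)
    rewrite -M0 Mz_mulop; congr M; apply: ev_inj => z.
    by rewrite ev_Mz ev0 scaler0.
  by rewrite fE; exists (ev f (origin R n)) => //=; rewrite -fE.
split; first by rewrite S_range; exists (const_fun H2E eta).
move=> _ [f [fS ->]]; rewrite hdot_sumr big1// => i _.
have := fS i; rewrite S_range => -[h _ <-].
by rewrite Mz_mulop hdot_M_const//; apply: hdot_sym0; exact: hdot_Mz_const.
Qed.

Let val_tuple_pow k x : cs_val (tuple_pow Mz_S k x) = tuple_pow (Mz HKE) k (cs_val x).
Proof.
apply: (tuple_pow_rel (Rel := fun x y => cs_val x = y)) => // i a _ <-.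
by [].
Qed.

Lemma wandering_restrict : wandering Mz_S W_S.
Proof.
have [S0 SL] := cs_subspace S.
have [O0 OL] := orthogonal_set_subspace (tuple_range_sum (Mz HKE) (cs_set S)).
split.
- split=> [|a x y [Sx Ox] [Sy Oy]]; first by split.
  by split; [exact: SL|exact: OL].
- apply: closed_preimage_hilbert; first exact: cs_val_continuous.
  by apply: closedI; [exact: cs_closed|exact: closed_orthogonal_set].
- move=> k k0 x _ Wx [y Wy <-].
  have := range_const_orthogonal k0; rewrite -wandering_subspaceE => WT.
  change (hdot (cs_val x) (cs_val (tuple_pow Mz_S k y)) = 0).
  by rewrite val_tuple_pow; apply: WT => //; exists (cs_val y).
Qed.

(** * The generating criterion *)

Section Generating.
Variable H2F : rkhs (drury_arveson_kernel R n) (subspaceType F).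

Let emb := subspace_embedding H2E H2F.

Let emb_subspace : is_subspace emb.
Proof.
split=> [|a f1 f2 [g1 fg1] [g2 fg2]].
  by exists 0 => z; rewrite !ev0.
by exists (a *: g1 + g2) => z; rewrite !evD !evZ fg1 fg2.
Qed.

Let emb_Mz i f : emb f -> emb (Mz H2E i f).
Proof. by move=> [g fg]; exists (Mz H2F i g) => z; rewrite !ev_Mz fg. Qed.

Let emb_const eta : cs_set F eta -> emb (const_fun H2E eta).
Proof.
move=> Feta; exists (const_fun H2F (SubspaceElt (asboolT Feta))) => z.
by rewrite !ev_const_fun.
Qed.

Let D := linear_span (\bigcup_(k in [set: 'I_n -> nat]) (tuple_pow Mz_S k @` W_S)).

Let span_sub_image : @cs_val R HKE S @` D `<=` M @` emb.
Proof.
suff : D `<=` [set d | exists2 f, emb f & M f = cs_val d].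
  by move=> DM _ [d /DM[f ef fd] <-]; exists f.
apply: linear_span_min.
  have [e0 eL] := emb_subspace.
  split=> [|a x y [f ef fx] [g eg gy]]; first by exists 0.
  by exists (a *: f + g); [exact: eL|rewrite M_linear fx gy].
move=> _ [k _ [x Wx <-]].
have : range_const HKE Theta0 (cs_val x) by rewrite -wandering_subspaceE.
rewrite range_constE => -[eta Feta xE].
exists (tuple_pow (Mz H2E) k (const_fun H2E eta)); last first.
  by rewrite -tuple_pow_mulop val_tuple_pow xE.
(* The relation ignores its second argument, so [0] is a dummy and the lemma expresses invariance of
   [emb]. *)
apply: (@tuple_pow_rel _ _ _ _ (fun f (_ : H2E) => emb f) _ (Mz H2E) k _ 0)
  => // [i f _|].
  exact: emb_Mz.
exact: emb_const.
Qed.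

(** [M] sends a monomial [z^k eta] to a power of the shift applied to an element of [W]; density of
    the monomials and continuity of [M] do the rest. *)
Let image_sub_closure : M @` emb `<=` closure (@cs_val R HKE S @` D).
Proof.
suff ML : M @` linear_span (monomials (H := H2E) (cs_set F)) `<=` @cs_val R HKE S @` D.
  move=> _ [f [g fg] <-]; apply: (closure_subset ML).
  apply: (image_closure M_continuous); exists f => //.
  by apply: closure_monomials => z; rewrite fg; exact: cs_valP.
suff : linear_span (monomials (H := H2E) (cs_set F)) `<=`
    [set f | exists2 d, D d & cs_val d = M f].
  by move=> LM _ [f /LM[d Dd dM] <-]; exists d.
have [D0 DL] := linear_span_subspace _ : is_subspace D.
apply: linear_span_min.
  split=> [|a f g [d Dd dM] [d' Dd' dM']]; first by exists 0.
  by exists (a *: d + d'); [exact: DL|rewrite /= dM dM' M_linear].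
move=> _ [k _ [_ [eta Feta <-] <-]].
have Sx : cs_set S (M (const_fun H2E eta)) by rewrite S_range; exists (const_fun H2E eta).
exists (tuple_pow Mz_S k (SubspaceElt (asboolT Sx))).
  apply: sub_linear_span; exists k => //; eexists; last by [].
  rewrite /W_S /preimage /=.
  by rewrite wandering_subspaceE range_constE; exists eta.
by rewrite val_tuple_pow tuple_pow_mulop.
Qed.

Lemma generatingE : generating Mz_S W_S <-> cs_set S = closure (M @` emb).
Proof.
split=> [[_ DT]|SE].
  apply/seteqP; split=> [x Sx|].
    have Dx : closure D (SubspaceElt (asboolT Sx)) by rewrite [closure _](esym DT).
    apply: (closure_subset span_sub_image).
    apply: (image_closure (@cs_val_continuous R HKE S)).
    by exists (SubspaceElt (asboolT Sx)).
  apply: closure_min_closed; first exact: cs_closed.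
  by move=> _ [f _ <-]; rewrite S_range; exists f.
split; first exact: wandering_restrict.
(* Generation is a closure inside [S], while the hypothesis is a closure in the ambient space. *)
apply/seteqP; split=> // x _; apply: closure_cs_val.
rewrite -closure_closure; apply: (closure_subset image_sub_closure).
by have := cs_valP x; rewrite SE.
Qed.

End Generating.
End Range.
End PartiallyIsometricMultiplier.

Theorem theorem6p6 (R : realType) (n : nat)
    (K : unit_ball R n -> unit_ball R n -> R[i]) (K_pd : positive_definite K)
    (HK : rkhs K R[i]) (HK_contractive : contractive_analytic HK)
    (Es : hilbertType R) (HKE : rkhs K Es)
    (E : hilbertType R) (H2E : rkhs (drury_arveson_kernel R n) E)
    (Theta : unit_ball R n -> boundedOp E Es)
    (Theta_multiplier : multiplier H2E HKE Theta)
    (Theta_partial_isometry : partial_isometry (mulop H2E HKE Theta))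
    (S : closedSubspace HKE)
    (S_invariant : invariant_under (Mz HKE) (cs_set S))
    (S_range : cs_set S = range (mulop H2E HKE Theta)) :
  let M_Theta := mulop H2E HKE Theta in
  let W := ominus (cs_set S) (tuple_range_sum (Mz HKE) (cs_set S)) in
  let W_S := @cs_val R HKE S @^-1` W in
  let Mz_S := tuple_restrict S_invariant in
  exists F : closedSubspace E,
    cs_set F = [set eta | adjoint M_Theta (M_Theta (const_fun H2E eta))
                          = const_fun H2E eta] /\
    let Theta0 := fun z => bop_restr (Theta z) F in
    [/\ K_inner HKE Theta0,
        W = range_const HKE Theta0,
        wandering Mz_S W_S &
        forall H2F : rkhs (drury_arveson_kernel R n) (subspaceType F),
          generating Mz_S W_S <->
          cs_set S = closure (M_Theta @` subspace_embedding H2E H2F)].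
Proof.
exists (fixed_space HKE H2E Theta); split.
  exact: fixed_spaceE.
split.
- exact: K_inner_fixed_space.
- exact: wandering_subspaceE.
- exact: wandering_restrict.
- by move=> H2F; exact: generatingE.
Qed.
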